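(* Let $\mathcal G=(V,E,\mathbf W)$ be a finite undirected weighted graph with $N$ vertices, and let $\mathbf S$ be a fixed real symmetric graph shift on $\mathcal G$. Let $\mathbf x_0$ be a stationary graph signal and let $\mathbf x_k$, $k\ge1$, be the stationary signals governed by the dynamical system $$\mathbf x_k=\mathbf A_k\mathbf x_{k-1}+\sigma_k\mathbf e_k,\qquad k\ge1,$$ where for each $k\ge1$ the matrix $\mathbf A_k$ is a polynomial filter of $\mathbf S$, $\sigma_k>0$, and $\mathbf e_k$ is a standard white noise independent of $\mathbf x_{k-1}$. Let the observations be $$\mathbf z_k=\mathbf B_k\mathbf x_k+\tilde\sigma_k\tilde{\mathbf e}_k,\qquad k\ge1,$$ where for each $k\ge1$ the matrix $\mathbf B_k$ is a polynomial filter of $\mathbf S$, $\tilde\sigma_k>0$, and $\tilde{\mathbf e}_k$ is a standard white noise independent of $\mathbf x_k$. Let $\widehat{\mathbf x}_0$ be an initial estimator of $\mathbf x_0$ such that the estimation error $\widehat{\mathbf x}_0-\mathbf x_0$ is stationary, and let $\widehat{\mathbf x}_k$, $k\ge1$, be the Kalman estimators defined recursively by $$\widehat{\mathbf x}_{k-1/2}=\mathbf A_k\widehat{\mathbf x}_{k-1},\qquad \widehat{\mathbf x}_k=\widehat{\mathbf x}_{k-1/2}+\mathbf K_k\big(\mathbf z_k-\mathbf B_k\widehat{\mathbf x}_{k-1/2}\big),$$ where the optimal Kalman filter $\mathbf K_k$ is determined by minimizing the mean squared error $\mathbb E\|\widehat{\mathbf x}_k-\mathbf x_k\|_2^2$ over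 $\mathbf K_k$. Then the estimators $\widehat{\mathbf x}_k$ and the estimation errors $\widehat{\mathbf x}_k-\mathbf x_k$, $k\ge1$, are stationary.
   Context: A graph shift on $\mathcal G$ is a matrix $\mathbf S=[S(i,j)]_{i,j\in V}$ with $S(i,j)=0$ unless $i=j$ or $(i,j)\in E$; here $\mathbf S$ is real and symmetric. A random graph signal is a real random vector indexed by $V$, and $\|\mathbf x\|_2=(\sum_{i\in V}|x(i)|^2)^{1/2}$. A polynomial filter of $\mathbf S$ is a matrix of the form $h(\mathbf S)=h_0\mathbf I+h_1\mathbf S+\dots+h_L\mathbf S^L$ for some polynomial $h$ with real coefficients. A random graph signal $\mathbf x$ is stationary if $\mathbb E\mathbf x=\mathbf 0$ and its covariance matrix $\mathrm{cov}(\mathbf x)=\mathbb E\big((\mathbf x-\mathbb E\mathbf x)(\mathbf x-\mathbb E\mathbf x)^\top\big)$ is a polynomial filter of $\mathbf S$. A standard white noise is a random graph signal $\mathbf e$ with $\mathbb E\mathbf e=\mathbf 0$ and $\mathrm{cov}(\mathbf e)=\mathbf I$, the identity matrix.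
   Formalization: Added, since the claim fails otherwise: the noises e_k and ẽ_k are each independent of the previous estimator x̂_{k-1}; and, only for stationarity of the estimators x̂_k, the cross-covariance of x_0 and x̂_0−x_0 is a polynomial filter of S. *)

(* Defs.v *)
From HB Require Import structures.
From mathcomp Require Import all_boot all_order all_algebra.
From mathcomp Require Import all_classical all_reals all_analysis.

Set Implicit Arguments.
Unset Strict Implicit.
Unset Printing Implicit Defensive.

Import Order.TTheory GRing.Theory Num.Theory.
Import numFieldNormedType.Exports.

Local Open Scope classical_set_scope.
Local Open Scope ring_scope.

(* No sign condition is put on the weights and loops are allowed: only the     *)
(* edge relation matters for graph shifts.                                     *)
Record wgraph (R : realType) (N : nat) := WGraph {
  edge : rel 'I_N;
  weight : 'M[R]_N;
  edge_sym : symmetric edge;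
  weight_sym : forall i j, weight i j = weight j i;
  weight_edge : forall i j, ~~ edge i j -> weight i j = 0
}.

Definition graph_shift (R : realType) (N : nat) (G : wgraph R N)
    (S : 'M[R]_N) : Prop :=
  forall i j, S i j != 0 -> (i == j) || edge G i j.

Definition poly_filter (R : realType) (n : nat) (S A : 'M[R]_n.+1) : Prop :=
  exists h : {poly R}, A = horner_mx S h.

Definition norm2 (R : realType) (N : nat) (v : 'cV[R]_N) : R :=
  Num.sqrt (\sum_i `|v i 0| ^+ 2).

Section signals.
Context {d : measure_display} {T : measurableType d} {R : realType}.
Variable P : probability T R.

Definition signal (N : nat) := T -> 'cV[R]_N.

Definition coord N (X : signal N) (i : 'I_N) : T -> R := fun w => X w i 0.

(* Measurability and finite second moments: this is what makes the mean and    *)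
(* the covariance matrix below meaningful.                                     *)
Definition square_integrable N (X : signal N) : Prop :=
  forall i, coord X i \in Lfun P 2%:E.

Definition mean N (X : signal N) : 'cV[R]_N :=
  \col_i fine 'E_P[coord X i].

Definition crosscov N (X Y : signal N) : 'M[R]_N :=
  \matrix_(i, j) fine (covariance P (coord X i) (coord Y j)).

Definition cov N (X : signal N) : 'M[R]_N := crosscov X X.

Definition stationary n (S : 'M[R]_n.+1) (X : signal n.+1) : Prop :=
  [/\ square_integrable X, mean X = 0 & poly_filter S (cov X)].

Definition white_noise N (e : signal N) : Prop :=
  [/\ square_integrable e, mean e = 0 & cov e = 1%:M].

(* sigma-algebra generated by the coordinates of X, i.e. the preimages under X *)
(* of the Borel subsets of R^N                                                 *)
Definition sigma_signal N (X : signal N) : set (set T) :=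
  <<s [set A | exists i : 'I_N, exists B : set R,
                 measurable B /\ A = coord X i @^-1` B] >>.

Definition independent N M (X : signal N) (Y : signal M) : Prop :=
  forall A B, sigma_signal X A -> sigma_signal Y B ->
    P (A `&` B) = (P A * P B)%E.

Definition mse N (X Y : signal N) : \bar R :=
  'E_P[fun w => norm2 (X w - Y w) ^+ 2].

End signals.

Definition kalman_update d (T : measurableType d) (R : realType) (N : nat)
    (A B K : 'M[R]_N) (xhat z : @signal d T R N) : @signal d T R N :=
  fun w => let xhalf := A *m xhat w in xhalf + K *m (z w - B *m xhalf).

(* Main.v *)
(* Only second moments matter: independence makes crosscovariances vanish. Let
   [u] be the previous error, [v = A u - sigma e] the forecast error and
   [M = A cov(u) A^T + sigma^2 I] its covariance. A gain [K] produces the error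
   [(I - K B) v + tsigma K te], whose mean squared norm is
   [tr ((I - K B) M (I - K B)^T + tsigma^2 K K^T)]. Completing the square with
   the positive definite [D = B M B^T + tsigma^2 I], the unique minimiser is
   [K = M B^T D^-1]. By Cayley-Hamilton [D^-1] is a polynomial in [S], hence so
   are [K], the error covariance and, by induction, the crosscovariance of state
   and error, which yields the covariance of the estimator. *)

From Pilot Require Import Defs.
From HB Require Import structures.
From mathcomp Require Import all_boot all_order all_algebra.
From mathcomp Require Import all_classical all_reals all_analysis.
From mathcomp Require Import measurable_realfun ring.
Import Order.TTheory GRing.Theory Num.Theory.
Import numFieldNormedType.Exports.
Local Open Scope classical_set_scope.
Local Open Scope ring_scope.

Set Implicit Arguments.
Unset Strict Implicit.

(** * Independence implies vanishing crosscovariance *)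

Section independence.
Context d (T : measurableType d) (R : realType) (P : probability T R).

Lemma Lfun2_Lfun1 (X : T -> R) : X \in Lfun P 2%:E -> X \in Lfun P 1.
Proof. exact/Lfun_subset12/fin_num_measure. Qed.

Lemma Lfun2_measurable (X : T -> R) :
  X \in Lfun P 2%:E -> measurable_fun setT X.
Proof. by move=> /[!inE] /andP[/[!inE]]. Qed.

Local Open Scope ereal_scope.


(* The joint law of [(X, Y)] is the product of the marginals, so Fubini applies. *)
Lemma product_law_expectationM (X Y : {RV P >-> R}) :
    (forall A B, measurable A -> measurable B ->
       P (X @^-1` A `&` Y @^-1` B) = P (X @^-1` A) * P (Y @^-1` B)) ->
    (X : T -> R) \in Lfun P 1 -> (Y : T -> R) \in Lfun P 1 ->
    (X \* Y)%R \in Lfun P 1 ->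
  'E_P[(X \* Y)%R] = 'E_P[X] * 'E_P[Y].
Proof.
move=> XY X1 Y1 XY1.
pose Z w := (X w, Y w).
have mZ : measurable_fun setT Z by exact/measurable_fun_pair.
pose ZRV : {RV P >-> (R * R)%type} :=
  HB.pack Z (isMeasurableFun.Build _ _ _ _ Z mZ).
pose f (p : R * R) := (p.1 * p.2)%:E.
have mf : measurable_fun setT f.
  by apply/measurable_EFinP; exact: measurable_funM.
have law A : measurable A ->
    (distribution P X \x distribution P Y) A = distribution P ZRV A.
  apply: product_measure_unique => C D mC mD.
  by rewrite -[RHS]XY.
have fZ : P.-integrable setT (f \o ZRV) by move/Lfun1_integrable : XY1.
(* Fubini needs integrability under the product measure. It holds under the joint law by
   pushforward, and the two measures agree on measurable sets. *)
have ifXY : (distribution P X \x distribution P Y).-integrable setT f.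
  have /integrableP[_ foo] := integrable_pushforward mZ mf fZ measurableT.
  apply/integrableP; split => //; apply: le_lt_trans foo.
  by rewrite le_eqVlt; apply/orP; left; apply/eqP/eq_measure_integral => A /law.
have iE (V : {RV P >-> R}) : (V : T -> R) \in Lfun P 1 ->
    (distribution P V).-integrable setT EFin.
  by move=> /Lfun1_integrable iV; exact: integrable_pushforward.
have EV (V : {RV P >-> R}) : (V : T -> R) \in Lfun P 1 ->
    \int[distribution P V]_r r%:E = 'E_P[V].
  by move=> /Lfun1_integrable iV; rewrite unlock integral_distribution.
transitivity (\int[distribution P ZRV]_p f p).
  by rewrite unlock integral_distribution.
transitivity (\int[distribution P X \x distribution P Y]_p f p).
  by apply: eq_measure_integral => A mA _; exact/esym/law.
rewrite -integral12_prod_meas1// /fubini_F /f/=.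
under eq_integral => r _.
  under eq_integral do rewrite EFinM.
  rewrite integralZl ?EV//; last exact: iE.
  rewrite -[X in _ * X]fineK; last exact: expectation_fin_num.
  over.
by rewrite integralZr ?iE// EV// fineK// expectation_fin_num.
Qed.

Lemma independent_crosscov N (X Y : signal N) :
  square_integrable P X -> square_integrable P Y -> independent P X Y ->
  crosscov P X Y = 0%R.
Proof.
move=> X2 Y2 XY; apply/matrixP => i j; rewrite !mxE.
have mX := Lfun2_measurable (X2 i); have mY := Lfun2_measurable (Y2 j).
have X1 := Lfun2_Lfun1 (X2 i); have Y1 := Lfun2_Lfun1 (Y2 j).
have XY1 := Lfun2_mul_Lfun1 (X2 i) (Y2 j).
pose XV : {RV P >-> R} :=
  HB.pack (Defs.coord X i) (isMeasurableFun.Build _ _ _ _ _ mX).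
pose YV : {RV P >-> R} :=
  HB.pack (Defs.coord Y j) (isMeasurableFun.Build _ _ _ _ _ mY).
rewrite covarianceE// (@product_law_expectationM XV YV)//.
  by rewrite subee// fin_numM// expectation_fin_num.
(* Preimages under a single coordinate are among the generators of [sigma_signal]. *)
move=> A B mA mB; apply: XY; apply: sub_sigma_algebra.
  by exists i; exists A.
by exists j; exists B.
Qed.

End independence.

(** * The algebra of polynomial filters *)

Section poly_filter.
Context (R : realType) (n : nat) (S : 'M[R]_n.+1).
Implicit Types A B : 'M[R]_n.+1.

Lemma poly_filterD A B :
  poly_filter S A -> poly_filter S B -> poly_filter S (A + B).
Proof. by move=> [p ->] [q ->]; exists (p + q); rewrite rmorphD. Qed.

Lemma poly_filterM A B :
  poly_filter S A -> poly_filter S B -> poly_filter S (A * B).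
Proof. by move=> [p ->] [q ->]; exists (p * q); rewrite rmorphM. Qed.

Lemma poly_filter_scalar a : poly_filter S a%:M.
Proof. by exists a%:P; rewrite horner_mx_C. Qed.

Lemma poly_filterZ a A : poly_filter S A -> poly_filter S (a *: A).
Proof. by move=> [p ->]; exists (a *: p); rewrite linearZ. Qed.

Lemma poly_filterB A B :
  poly_filter S A -> poly_filter S B -> poly_filter S (A - B).
Proof. by move=> [p ->] [q ->]; exists (p - q); rewrite rmorphB. Qed.

Lemma poly_filter_horner A p : poly_filter S A -> poly_filter S (horner_mx A p).
Proof.
move=> SA; elim/poly_ind: p => [|p c IHp].
  by rewrite rmorph0; exists 0; rewrite rmorph0.
rewrite rmorphD rmorphM/= horner_mx_X horner_mx_C.
by apply: poly_filterD (poly_filter_scalar c); exact: poly_filterM.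
Qed.

(* Cayley-Hamilton: the constant term of the characteristic polynomial is
   [(-1)^n det A], so the remaining terms exhibit the inverse of [A]. *)
Lemma poly_filterV A : A \in unitmx -> poly_filter S A -> poly_filter S A^-1.
Proof.
move=> uA SA; set p := char_poly A; set c := p`_0.
have c0 : c != 0.
  by rewrite /c char_poly_det mulf_neq0 ?signr_eq0// -unitfE -unitmxE.
set q := horner_mx A (drop_poly 1 p).
have qA : q * A = (- c)%:M.
  have := Cayley_Hamilton A; rewrite -/p -[p](poly_take_drop 1%N) expr1.
  have -> : take_poly 1 p = c%:P.
    by apply/polyP => -[|i]; rewrite coef_take_poly coefC.
  rewrite rmorphD rmorphM/= horner_mx_X horner_mx_C => /eqP.
  by rewrite addrC addr_eq0 => /eqP ->; rewrite raddfN.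
have -> : A^-1 = (- c)^-1 *: q.
  rewrite -[RHS](mulrK uA) -scalerAl qA -scalemx1 scalerA mulVf ?oppr_eq0//.
  by rewrite scale1r mul1r.
exact/poly_filterZ/poly_filter_horner.
Qed.

Lemma poly_filter_sym A : S^T = S -> poly_filter S A -> A^T = A.
Proof.
move=> symS [p ->]; elim/poly_ind: p => [|p c IHp].
  by rewrite rmorph0 trmx0.
rewrite rmorphD rmorphM/= horner_mx_X horner_mx_C linearD/= tr_scalar_mx.
rewrite trmx_mul symS IHp; congr (_ + _).
(* Transposition reversed the product. Writing [S] as the value of 'X at [S] turns commutation into
   commutativity of {poly R}. *)
by rewrite -[X in X *m _ = _ *m X]horner_mx_X !mulmxE -!rmorphM mulrC.
Qed.

End poly_filter.

(** * Minimising the trace of the error covariance *)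

Section trace_form.
Context (R : realType).

(** The trace sums the quadratic form of [M] over the rows of [Y], so this is the usual positive
    semidefiniteness, in the shape in which mean squared errors appear. *)
Definition psdmx n (M : 'M[R]_n) :=
  forall Y : 'M[R]_n, 0 <= \tr (Y *m M *m Y^T).

Lemma mxtrace_mul_tr n (Y : 'M[R]_n) :
  \tr (Y *m Y^T) = \sum_i \sum_j Y i j ^+ 2.
Proof.
by apply: eq_bigr => i _; rewrite mxE; apply: eq_bigr => j _; rewrite mxE expr2.
Qed.

Lemma mxtrace_mul_tr_ge0 n (Y : 'M[R]_n) : 0 <= \tr (Y *m Y^T).
Proof.
rewrite mxtrace_mul_tr; apply: sumr_ge0 => i _.
by apply: sumr_ge0 => j _; exact: sqr_ge0.
Qed.

Lemma mxtrace_mul_tr_eq0 n (Y : 'M[R]_n) : \tr (Y *m Y^T) = 0 -> Y = 0.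
Proof.
rewrite mxtrace_mul_tr => Y0; apply/matrixP => i j; rewrite mxE.
have Yi0 : \sum_j Y i j ^+ 2 = 0.
  apply: (psumr_eq0P _ Y0) => // k _.
  by apply: sumr_ge0 => l _; exact: sqr_ge0.
apply/eqP; rewrite -sqrf_eq0; apply/eqP.
by apply: (psumr_eq0P _ Yi0) => // l _; exact: sqr_ge0.
Qed.

Variables (n : nat) (M B : 'M[R]_n.+1) (s : R).
Hypotheses (psdM : psdmx M) (s0 : s != 0).

(** When [M] is the covariance of the forecast error, this is the covariance of the observation
    residual, the matrix D of the overview. *)
Definition innovation : 'M[R]_n.+1 := B *m M *m B^T + (s ^+ 2)%:M.

(** The trace splits into the form of [M] at [Y *m B], which is nonnegative, and s^2 times the
    squared Frobenius norm of [Y]. This definiteness gives both the invertibility of [innovation]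
    and the uniqueness of the optimal gain. *)
Lemma innovation_trace_le0 (Y : 'M[R]_n.+1) :
  \tr (Y *m innovation *m Y^T) <= 0 -> Y = 0.
Proof.
rewrite mulmxDr mulmxDl mul_mx_scalar -scalemxAl mxtraceD linearZ/= => le0.
apply: mxtrace_mul_tr_eq0; apply/eqP; rewrite eq_le mxtrace_mul_tr_ge0 andbT.
have /pmulr_rle0 <- : 0 < s ^+ 2 by rewrite exprn_even_gt0.
apply: le_trans le0; rewrite lerDr.
by have := psdM (Y *m B); rewrite trmx_mul !mulmxA.
Qed.

Lemma innovation_unit : innovation \in unitmx.
Proof.
(* Definiteness is applied with the kernel matrix itself as [Y]. *)
rewrite -row_free_unit -kermx_eq0; apply/eqP/innovation_trace_le0.
by rewrite mulmx_ker mul0mx mxtrace0.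
Qed.

Definition posterior_cov (K : 'M[R]_n.+1) : 'M[R]_n.+1 :=
  (1%:M - K *m B) *m M *m (1%:M - K *m B)^T + s ^+ 2 *: (K *m K^T).

Lemma posterior_covE K : M^T = M ->
  posterior_cov K =
  M - K *m (B *m M) - M *m B^T *m K^T + K *m innovation *m K^T.
Proof.
move=> symM; rewrite /posterior_cov /innovation linearB/= trmx1 trmx_mul.
rewrite mulmxBr mulmx1 !mulmxBl mul1mx mulmxDr mulmxDl mul_mx_scalar -scalemxAl.
rewrite !mulmxA; set a := K *m B *m M; set b := M *m B^T *m K^T.
set c := K *m B *m M *m B^T *m K^T.
by apply/matrixP => i j; rewrite !mxE; ring.
Qed.

(** No differentiation: the excess of [posterior_cov K] over its value at [K0] is the square (K -
    K0) D (K - K0)^T. Comparing [K] with [K0] makes its trace nonpositive, which forces K = K0. *)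
Lemma optimal_gainE K : M^T = M ->
    (forall K', \tr (posterior_cov K) <= \tr (posterior_cov K')) ->
  K = M *m B^T *m invmx innovation.
Proof.
move=> symM opt; set K0 := M *m B^T *m _.
set D := innovation in K0 *.
have symD : D^T = D.
  by rewrite /D /innovation linearD/= tr_scalar_mx !trmx_mul trmxK symM mulmxA.
(* This identity and its transpose express the linear terms of [posterior_covE] through D, so that
   the square can be completed. *)
have K0D : M *m B^T = K0 *m D by rewrite mulmxKV// innovation_unit.
have DK0 : B *m M = D *m K0^T.
  by rewrite -[LHS]trmxK trmx_mul symM K0D trmx_mul symD.
apply/eqP; rewrite -subr_eq0; apply/eqP/innovation_trace_le0.
have -> : (K - K0) *m innovation *m (K - K0)^T
    = posterior_cov K - posterior_cov K0.
  rewrite !posterior_covE// -/D K0D DK0 linearB/= mulmxBl mulmxBr !mulmxBl.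
  rewrite !mulmxA.
  set a := K *m D *m K0^T; set b := K0 *m D *m K^T.
  set c := K *m D *m K^T; set e := K0 *m D *m K0^T.
  by apply/matrixP => i j; rewrite !mxE; ring.
by rewrite linearB/= subr_le0.
Qed.

End trace_form.

(** * Means and covariances of linear images and sums of signals *)

Section second_order.
Context d (T : measurableType d) (R : realType) (P : probability T R).

Lemma coordD N (X Y : @signal d T R N) i :
  Defs.coord (X \+ Y) i = Defs.coord X i \+ Defs.coord Y i.
Proof. by apply/funext => w; rewrite /Defs.coord/= mxE. Qed.

Lemma coord_mulmx N (A : 'M[R]_N) (X : @signal d T R N) i :
  Defs.coord (mulmx A \o X) i = \sum_k (A i k \o* Defs.coord X k).
Proof.
apply/funext => w; rewrite /Defs.coord/= mxE fct_sumE.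
by apply: eq_bigr => k _; rewrite /= mulrC.
Qed.

Lemma square_integrableD N (X Y : signal N) :
  square_integrable P X -> square_integrable P Y ->
  square_integrable P (X \+ Y).
Proof. by move=> X2 Y2 i; rewrite coordD; apply: rpredD; rewrite ?lee1n. Qed.

Lemma square_integrable_mulmx N (A : 'M[R]_N) (X : signal N) :
  square_integrable P X -> square_integrable P (mulmx A \o X).
Proof.
move=> X2 i; rewrite coord_mulmx; apply: rpred_sum; rewrite ?lee1n// => p1 k _.
by apply: Lfun_scale; rewrite ?ler1n//; exact: X2.
Qed.

Lemma meanD N (X Y : signal N) :
  square_integrable P X -> square_integrable P Y ->
  mean P (X \+ Y) = mean P X + mean P Y.
Proof.
move=> X2 Y2; apply/colP => i; rewrite !mxE coordD expectationD.
- by rewrite fineD// expectation_fin_num//; exact: Lfun2_Lfun1.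
- exact: Lfun2_Lfun1.
- exact: Lfun2_Lfun1.
Qed.

Lemma mean_mulmx N (A : 'M[R]_N) (X : signal N) :
  square_integrable P X -> mean P (mulmx A \o X) = A *m mean P X.
Proof.
move=> X2; apply/colP => i; rewrite !mxE coord_mulmx.
have X1 k : A i k \o* Defs.coord X k \in Lfun P 1.
  by apply: Lfun_scale => //; exact: Lfun2_Lfun1.
rewrite -(big_map (fun k => A i k \o* Defs.coord X k) xpredT id).
rewrite expectation_sum/=.
  rewrite big_map -sum_fine => [|k _]; last exact: expectation_fin_num.
  apply: eq_bigr => k _; rewrite mxE expectationZl ?Lfun2_Lfun1//.
  by rewrite fineM// expectation_fin_num// Lfun2_Lfun1.
by move=> _ /mapP[k _ ->].
Qed.

Lemma covariance_fin_num2 (X Y : T -> R) :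
  X \in Lfun P 2%:E -> Y \in Lfun P 2%:E -> covariance P X Y \is a fin_num.
Proof.
move=> X2 Y2; apply: covariance_fin_num; [exact: Lfun2_Lfun1..|].
exact: Lfun2_mul_Lfun1.
Qed.

Lemma trmx_crosscov N (X Y : signal N) :
  (crosscov P X Y)^T = crosscov P Y X.
Proof. by apply/matrixP => i j; rewrite !mxE covarianceC. Qed.

Lemma crosscovDl N (X Y Z : signal N) :
  square_integrable P X -> square_integrable P Y -> square_integrable P Z ->
  crosscov P (X \+ Y) Z = crosscov P X Z + crosscov P Y Z.
Proof.
move=> X2 Y2 Z2; apply/matrixP => i j; rewrite !mxE coordD covarianceDl//.
by rewrite fineD// covariance_fin_num2.
Qed.

Lemma crosscovDr N (X Y Z : signal N) :
  square_integrable P X -> square_integrable P Y -> square_integrable P Z ->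
  crosscov P Z (X \+ Y) = crosscov P Z X + crosscov P Z Y.
Proof.
by move=> *; rewrite -trmx_crosscov crosscovDl// linearD/= !trmx_crosscov.
Qed.

Lemma crosscov_mulmxl N (A : 'M[R]_N) (X Y : signal N) :
  square_integrable P X -> square_integrable P Y ->
  crosscov P (mulmx A \o X) Y = A *m crosscov P X Y.
Proof.
move=> X2 Y2; apply/matrixP => i j; rewrite !mxE coord_mulmx.
have AX2 k : A i k \o* Defs.coord X k \in Lfun P 2%:E.
  by apply: Lfun_scale; rewrite ?ler1n//; exact: X2.
transitivity
    (\sum_k fine (covariance P (A i k \o* Defs.coord X k) (Defs.coord Y j))).
  (* Additivity of covariance is binary, so the sum is peeled off term by term; each partial sum
     must again lie in L^2. *)
  elim: (index_enum _) => [|k s IHs].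
    by rewrite !big_nil covariance_cst_l.
  have sAX2 : \sum_(k <- s) (A i k \o* Defs.coord X k) \in Lfun P 2%:E.
    by apply: rpred_sum; rewrite ?lee1n.
  by rewrite !big_cons covarianceDl// fineD ?IHs// covariance_fin_num2.
apply: eq_bigr => k _; rewrite mxE covarianceZl.
- by rewrite fineM// covariance_fin_num2.
- exact: Lfun2_Lfun1.
- exact: Lfun2_Lfun1.
- exact: Lfun2_mul_Lfun1.
Qed.

Lemma crosscov_mulmxr N (A : 'M[R]_N) (X Y : signal N) :
  square_integrable P X -> square_integrable P Y ->
  crosscov P Y (mulmx A \o X) = crosscov P Y X *m A^T.
Proof.
by move=> *; rewrite -trmx_crosscov crosscov_mulmxl// trmx_mul trmx_crosscov.
Qed.

Lemma cov_mulmx N (A : 'M[R]_N) (X : signal N) :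
  square_integrable P X -> cov P (mulmx A \o X) = A *m cov P X *m A^T.
Proof.
move=> X2; rewrite /cov crosscov_mulmxl ?crosscov_mulmxr ?mulmxA//.
exact: square_integrable_mulmx.
Qed.

Lemma cov_uncorrelatedD N (X Y : signal N) :
  square_integrable P X -> square_integrable P Y -> crosscov P X Y = 0 ->
  cov P (X \+ Y) = cov P X + cov P Y.
Proof.
move=> X2 Y2 XY.
have YX : crosscov P Y X = 0 by rewrite -trmx_crosscov XY trmx0.
rewrite /cov crosscovDl ?crosscovDr ?XY ?YX ?addr0 ?add0r//.
exact: square_integrableD.
Qed.

(** The trace is the sum of the variances of the coordinates of Y X. *)
Lemma cov_psd N (X : signal N) : square_integrable P X -> psdmx (cov P X).
Proof.
move=> X2 Y; rewrite -cov_mulmx//; apply: sumr_ge0 => i _.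
by rewrite mxE fine_ge0// variance_ge0.
Qed.

Lemma mse_trace_cov N (X Y : signal N) :
    square_integrable P (fun w => X w - Y w) ->
    mean P (fun w => X w - Y w) = 0 ->
  mse P X Y = (\tr (cov P (fun w => X w - Y w)))%:E.
Proof.
set U := fun w => X w - Y w => U2 U0.
have -> : mse P X Y = ('E_P[\sum_i (Defs.coord U i \* Defs.coord U i)])%E.
  congr expectation; apply/funext => w; rewrite -/(U w) /norm2.
  rewrite sqr_sqrtr; last first.
    by apply: sumr_ge0 => i _; exact: sqr_ge0.
  rewrite fct_sumE; apply: eq_bigr => i _.
  by rewrite real_normK ?num_real// expr2.
rewrite -(big_map (fun i => Defs.coord U i \* Defs.coord U i) xpredT id).
rewrite expectation_sum/=.
  rewrite big_map /mxtrace -sumEFin; apply: eq_bigr => i _; rewrite mxE.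
  rewrite fineK; last exact: covariance_fin_num2.
  (* With zero mean, the second moment of each coordinate is its variance, a diagonal entry of the
     covariance matrix. *)
  have /colP/(_ i) := U0; rewrite !mxE => Ui0.
  rewrite covariance.unlock Ui0; congr expectation; apply/funext => w.
  by rewrite !fctE/= !subr0.
by move=> _ /mapP[i _ ->]; exact: Lfun2_mul_Lfun1.
Qed.

End second_order.

(** * One step of the Kalman recursion *)

Section kalman_step.
Context d (T : measurableType d) (R : realType) (P : probability T R).
Variables (n : nat) (S A B K : 'M[R]_n.+1) (sigma tsigma : R).
Variables (x xhat e te x1 z1 : @signal d T R n.+1).
Hypotheses (S_sym : S^T = S)
  (SA : poly_filter S A) (SB : poly_filter S B) (tsigma0 : 0 < tsigma)
  (x_stat : stationary P S x)
  (err_stat : stationary P S (fun w => xhat w - x w))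
  (e_white : white_noise P e) (te_white : white_noise P te)
  (e_indep_x : independent P e x) (e_indep_xhat : independent P e xhat)
  (te_indep_x1 : independent P te x1) (te_indep_xhat : independent P te xhat)
  (x1E : forall w, x1 w = A *m x w + sigma *: e w)
  (z1E : forall w, z1 w = B *m x1 w + tsigma *: te w)
  (K_opt : forall K',
     (mse P (kalman_update A B K xhat z1) x1 <=
      mse P (kalman_update A B K' xhat z1) x1)%E).

Let err w := xhat w - x w.
(** The error A xhat - x1 before the observation is used. Scalars are written as scalar matrices so
    that the rules for linear images apply to the noise as well. *)
Let forecast_err := (mulmx A \o err) \+ (mulmx (- sigma)%:M \o e).
Let err1 K' w := kalman_update A B K' xhat z1 w - x1 w.

Let x2 : square_integrable P x. Proof. by case: x_stat. Qed.
Let err2 : square_integrable P err. Proof. by case: err_stat. Qed.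
Let e2 : square_integrable P e. Proof. by case: e_white. Qed.
Let te2 : square_integrable P te. Proof. by case: te_white. Qed.

Let xhatE : xhat = x \+ err.
Proof. by apply/funext => w; rewrite /err/= addrCA subrr addr0. Qed.

Let xhat2 : square_integrable P xhat.
Proof. by rewrite xhatE; exact: square_integrableD. Qed.

Let x1E' : x1 = (mulmx A \o x) \+ (mulmx sigma%:M \o e).
Proof. by apply/funext => w; rewrite x1E /= mul_scalar_mx. Qed.

Let x12 : square_integrable P x1.
Proof.
by rewrite x1E'; apply: square_integrableD; exact: square_integrable_mulmx.
Qed.

Let forecast_err2 : square_integrable P forecast_err.
Proof. by apply: square_integrableD; exact: square_integrable_mulmx. Qed.

Let forecast_errE : forecast_err = (mulmx A \o xhat) \+ (mulmx (- 1)%:M \o x1).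
Proof.
apply/funext => w; rewrite /forecast_err/= !mul_scalar_mx x1E /err mulmxBr.
by rewrite scaleN1r scaleNr opprD addrA.
Qed.

Let err1E K' :
  err1 K' = (mulmx (1%:M - K' *m B) \o forecast_err) \+
            (mulmx (tsigma *: K') \o te).
Proof.
apply/funext => w; rewrite /err1 /kalman_update forecast_errE z1E/=.
rewrite mul_scalar_mx scaleN1r !mulmxDr !mulmxN !mulmxBl !mul1mx !mulmxA.
rewrite -scalemxAl scalemxAr.
set a := A *m _; set b := K' *m B *m x1 w; set c := K' *m (_ *: _).
set f := K' *m B *m A *m xhat w.
by apply/colP => i; rewrite !mxE; ring.
Qed.

(** Independence from [x] and from [xhat] separately need not give independence from their
    difference, but by bilinearity it does give zero crosscovariance. *)
Let e_err : crosscov P e err = 0.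
Proof.
have := independent_crosscov e2 xhat2 e_indep_xhat.
by rewrite xhatE crosscovDr// independent_crosscov// add0r.
Qed.

Let te_x1 : crosscov P te x1 = 0. Proof. exact: independent_crosscov. Qed.

Let te_forecast_err : crosscov P te forecast_err = 0.
Proof.
have mA2 := square_integrable_mulmx.
(* In the form A xhat - x1, both terms are independent of [te]. *)
rewrite forecast_errE crosscovDr ?crosscov_mulmxr//; try exact: mA2.
by rewrite te_x1 independent_crosscov// !mul0mx addr0.
Qed.

Let M := cov P forecast_err.

Let M_E : M = A *m cov P err *m A^T + (sigma ^+ 2)%:M.
Proof.
have mA2 := square_integrable_mulmx.
rewrite /M cov_uncorrelatedD; try exact: mA2.
  rewrite !cov_mulmx//; case: e_white => _ _ ->.
  by rewrite mulmx1 tr_scalar_mx -scalar_mxM mulrNN expr2.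
rewrite crosscov_mulmxl ?crosscov_mulmxr//; last exact: mA2.
by rewrite -trmx_crosscov e_err trmx0 mul0mx mulmx0.
Qed.

Let SM : poly_filter S M.
Proof.
rewrite M_E (poly_filter_sym S_sym SA).
apply: poly_filterD (poly_filter_scalar _ _).
by do 2?[apply: poly_filterM => //]; case: err_stat.
Qed.

Let err12 K' : square_integrable P (err1 K').
Proof.
rewrite err1E.
by apply: square_integrableD; exact: square_integrable_mulmx.
Qed.

Let err1_mean K' : mean P (err1 K') = 0.
Proof.
have mA2 := square_integrable_mulmx.
rewrite err1E meanD ?mean_mulmx//; try exact: mA2.
rewrite meanD ?mean_mulmx//; try exact: mA2.
case: err_stat e_white te_white => _ -> _ [_ -> _] [_ -> _].
by rewrite !(mulmx0, addr0).
Qed.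

Let err1_cov K' : cov P (err1 K') = posterior_cov M B tsigma K'.
Proof.
have mA2 := square_integrable_mulmx.
rewrite err1E cov_uncorrelatedD; try exact: mA2.
  rewrite !cov_mulmx//; case: te_white => _ _ ->.
  by rewrite mulmx1 linearZ/= -scalemxAl -scalemxAr scalerA -expr2.
rewrite crosscov_mulmxl ?crosscov_mulmxr//; last exact: mA2.
by rewrite -trmx_crosscov te_forecast_err trmx0 mul0mx mulmx0.
Qed.

Let psdM : psdmx M. Proof. exact: cov_psd. Qed.

Let ts0 : tsigma != 0. Proof. by rewrite gt_eqF. Qed.

Lemma optimal_gain_poly_filter : poly_filter S K.
Proof.
rewrite (@optimal_gainE _ _ M B tsigma psdM ts0 K).
- have SBT : poly_filter S B^T by rewrite (poly_filter_sym S_sym SB).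
  apply: poly_filterM; first exact: poly_filterM.
  apply: poly_filterV; first exact: innovation_unit.
  apply: poly_filterD (poly_filter_scalar _ _).
  by do 2?[apply: poly_filterM => //].
- exact: trmx_crosscov.
(* For every gain the error has mean zero, so its mean squared error is the trace of
   [posterior_cov], and [K_opt] becomes the trace inequality. *)
- move=> K'; rewrite -!err1_cov -lee_fin.
  by have := K_opt K'; rewrite !mse_trace_cov;
    try exact: err12; try exact: err1_mean.
Qed.

Let SI : poly_filter S (1%:M - K *m B).
Proof.
apply: poly_filterB (poly_filter_scalar _ _) _.
exact: poly_filterM optimal_gain_poly_filter SB.
Qed.

Lemma kalman_error_stationary : stationary P S (err1 K).
Proof.
have SK := optimal_gain_poly_filter.
split => //; rewrite err1_cov /posterior_cov.
rewrite (poly_filter_sym S_sym SI) (poly_filter_sym S_sym SK).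
apply: poly_filterD; last exact/poly_filterZ/poly_filterM.
by do 2?[apply: poly_filterM => //].
Qed.

(** With C the old crosscovariance, the new one is (A C A^T - sigma^2 I) (I - K B)^T: the noise [e]
    enters the state and the forecast error with opposite signs, and [te] is uncorrelated with
    [x1]. *)
Lemma kalman_crosscov_poly_filter :
  poly_filter S (crosscov P x err) -> poly_filter S (crosscov P x1 (err1 K)).
Proof.
have mA2 := square_integrable_mulmx => Sxe.
rewrite err1E crosscovDr ?crosscov_mulmxr//; try exact: mA2.
rewrite -[crosscov P x1 te]trmx_crosscov te_x1 trmx0 mul0mx addr0.
rewrite (poly_filter_sym S_sym SI); apply: poly_filterM SI.
rewrite x1E' /forecast_err.
rewrite crosscovDl ?crosscovDr ?crosscov_mulmxl ?crosscov_mulmxr//;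
  try exact: mA2; try exact: square_integrableD.
rewrite e_err -[crosscov P x e]trmx_crosscov (independent_crosscov e2 x2)//.
rewrite trmx0 !(mul0mx, mulmx0) addr0 add0r.
case: e_white => _ _; rewrite /cov => ->.
rewrite (poly_filter_sym S_sym SA) mul1mx tr_scalar_mx -scalar_mxM.
apply: poly_filterD (poly_filter_scalar _ _).
by do 2?[apply: poly_filterM => //].
Qed.

End kalman_step.

(** * From the error to the estimator, and induction over time *)

Lemma stationary_estimator d (T : measurableType d) (R : realType)
    (P : probability T R) n (S : 'M[R]_n.+1) (x xhat : @signal d T R n.+1) :
    S^T = S ->
    stationary P S x -> stationary P S (fun w => xhat w - x w) ->
    poly_filter S (crosscov P x (fun w => xhat w - x w)) ->
  stationary P S xhat.
Proof.
set u := fun w => xhat w - x w.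
move=> S_sym [x2 x0 Sx] [u2 u0 Su] Sxu.
have -> : xhat = x \+ u.
  by apply/funext => w; rewrite /u/= addrCA subrr addr0.
clearbody u; split; first exact: square_integrableD.
  by rewrite meanD// x0 u0 addr0.
(* Expanding cov(x + u) leaves both crosscovariances; the second is the transpose of the first,
   hence equal to it, as filters of a symmetric shift are symmetric. *)
rewrite /cov crosscovDl ?crosscovDr//; last exact: square_integrableD.
rewrite -[crosscov P u x]trmx_crosscov (poly_filter_sym S_sym Sxu).
by apply: poly_filterD; exact: poly_filterD.
Qed.

(** The covariance of an estimator contains the crosscovariance of state and error, which
    stationarity of each of the two does not control. The claim on estimators therefore starts from
    an initial crosscovariance that is a filter. *)
Theorem mainTheorem3 (d : measure_display) (T : measurableType d) (R : realType)
    (P : probability T R) (n : nat)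
    (G : wgraph R n.+1) (S : 'M[R]_n.+1)
    (S_shift : graph_shift G S) (S_sym : S^T = S)
    (A B K : nat -> 'M[R]_n.+1) (sigma tsigma : nat -> R)
    (x xhat e te z : nat -> @signal d T R n.+1)
    (* state equation *)
    (x_stat : forall k, stationary P S (x k))
    (A_filter : forall k, poly_filter S (A k.+1))
    (sigma_gt0 : forall k, 0 < sigma k.+1)
    (e_white : forall k, white_noise P (e k.+1))
    (e_indep_x : forall k, independent P (e k.+1) (x k))
    (x_eq : forall k w,
       x k.+1 w = A k.+1 *m x k w + sigma k.+1 *: e k.+1 w)
    (* observations *)
    (B_filter : forall k, poly_filter S (B k.+1))
    (tsigma_gt0 : forall k, 0 < tsigma k.+1)
    (te_white : forall k, white_noise P (te k.+1))
    (te_indep_x : forall k, independent P (te k.+1) (x k.+1))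
    (z_eq : forall k w,
       z k.+1 w = B k.+1 *m x k.+1 w + tsigma k.+1 *: te k.+1 w)
    (* Kalman estimators *)
    (err0_stat : stationary P S (fun w => xhat 0%N w - x 0%N w))
    (xhat_eq : forall k,
       xhat k.+1 = kalman_update (A k.+1) (B k.+1) (K k.+1) (xhat k) (z k.+1))
    (K_opt : forall k (K' : 'M[R]_n.+1),
       (mse P (xhat k.+1) (x k.+1) <=
        mse P (kalman_update (A k.+1) (B k.+1) K' (xhat k) (z k.+1))
              (x k.+1))%E)
    (* the noises of step k+1 are independent of the previous estimator *)
    (e_indep_xhat : forall k, independent P (e k.+1) (xhat k))
    (te_indep_xhat : forall k, independent P (te k.+1) (xhat k)) :
  (forall k, stationary P S (fun w => xhat k.+1 w - x k.+1 w)) /\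
  ((* joint stationarity of the initial state and of the initial error *)
   poly_filter S (crosscov P (x 0%N) (fun w => xhat 0%N w - x 0%N w)) ->
   forall k, stationary P S (xhat k.+1)).
Proof.
have opt k K' :
    (mse P (kalman_update (A k.+1) (B k.+1) (K k.+1) (xhat k) (z k.+1))
      (x k.+1) <= mse P (kalman_update (A k.+1) (B k.+1) K' (xhat k) (z k.+1))
      (x k.+1))%E.
  by rewrite -xhat_eq.
have err_stat k : stationary P S (fun w => xhat k w - x k w).
  elim: k => [//|k IHk]; rewrite xhat_eq.
  by apply: (kalman_error_stationary (sigma := sigma k.+1) (e := e k.+1)
    (te := te k.+1) (tsigma := tsigma k.+1) (x := x k)).
split=> [//|cross0 k].
(* The induction starts at time 0 from [cross0]; each step uses the stationarity of the previous
   error, already known at all times. *)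
have cross j : poly_filter S (crosscov P (x j) (fun w => xhat j w - x j w)).
  elim: j => [//|j IHj]; rewrite xhat_eq.
  by apply: (kalman_crosscov_poly_filter (sigma := sigma j.+1) (e := e j.+1)
    (te := te j.+1) (tsigma := tsigma j.+1) (x := x j)).
exact: stationary_estimator.
Qed.
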